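(* Let $r$ be a positive integer and let $P$ be an $r$-differential poset with rank sizes $p_n=|P_n|$ and rank gaps $\Delta p_n = p_n - p_{n-1}$. For $n \ge 0$ let $\tau_n$ be the number of thread elements in $P_n$. Then for all integers $n \ge 0$ and $N \geq 4n$, $$\Delta p_N \geq \tau_n.$$
   Context: Let $P$ be an $\mathbb{N}$-graded poset with $n$-th rank $P_n$ ($n \ge 0$), and let $\lessdot$ denote its covering relation. Let $\mathbb{Q}P_n$ be the $\mathbb{Q}$-vector space with basis $P_n$ (with $P_{-1}=\emptyset$, so $p_{-1}=0$). The up and down operators $U_n : \mathbb{Q}P_n \to \mathbb{Q}P_{n+1}$ and $D_n : \mathbb{Q}P_n \to \mathbb{Q}P_{n-1}$ are the linear maps given for $x \in P_n$ by $U_n x = \sum_{y : x \lessdot y} y$ and $D_n x = \sum_{z : z \lessdot x} z$. For a positive integer $r$, an $r$-differential poset is a locally finite $\mathbb{N}$-graded poset $P$ with unique minimal element $\hat{0}$ (so $P_0=\{\hat 0\}$) such that the operators above are well defined (each element is covered by finitely many elements, so that all ranks are finite) and $D_{n+1}U_n - U_{n-1}D_n = r\cdot I$ on $\mathbb{Q}P_n$ for all $n \geq 0$. An element $x \in P$ is a singleton if $x = \hat{0}$ or $x$ covers exactly one element of $P$. A thread element is a singleton $x \in P$ which covers another singleton (in particular $\hat 0$, which covers nothing, is not a thread element, so $\tau_0=0$). *)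

(* Defs.v *)
From mathcomp Require Import all_boot all_order all_algebra.
From mathcomp Require Import finmap boolp classical_sets cardinality.
From mathcomp Require Import freeg.

Set Implicit Arguments.
Unset Strict Implicit.
Unset Printing Implicit Defensive.

Import Order.TTheory GRing.Theory Num.Theory.

Local Open Scope classical_set_scope.
Local Open Scope order_scope.
Local Open Scope ring_scope.

Section Poset.
Context {d : Order.disp_t} {P : porderType d}.
Implicit Types (x y z : P) (rk : P -> nat) (hatzero : P).

Definition covers x y : Prop := (x < y)%O /\ (forall z, ~ (x < z < y)%O).

Definition upper_covers x : set P := [set y | covers x y].
Definition lower_covers x : set P := [set z | covers z x].

Definition minimal_elt x : Prop := forall y, (y <= x)%O -> y = x.

Definition locally_finite : Prop :=
  forall x y, finite_set [set z | (x <= z <= y)%O].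

Record graded_by rk : Prop := GradedBy {
  graded_lt : forall x y, (x < y)%O -> (rk x < rk y)%N;
  graded_covers : forall x y, covers x y -> rk y = (rk x).+1;
  graded_minimal : forall x, minimal_elt x -> rk x = 0%N
}.

Definition rank_set rk (n : nat) : set P := [set x | rk x = n].

(* QP, with basis P, is the direct sum of the QP_n; [fset_set A] is the
   finite set underlying A, and is empty when A is infinite. Infinite sets are
   excluded in [differential_poset], so U and D are the intended sums there. *)
Definition U : {freeg P / rat} -> {freeg P / rat} :=
  fglift (fun x => \sum_(y <- fset_set (upper_covers x)) << y >>).

Definition D : {freeg P / rat} -> {freeg P / rat} :=
  fglift (fun x => \sum_(z <- fset_set (lower_covers x)) << z >>).

Definition in_QP rk (n : nat) (v : {freeg P / rat}) : Prop :=
  forall x, x \in dom v -> rk x = n.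

(* As U and D shift the rank by +1 and -1 on QP, [D (U v) - U (D v)] for v in
   QP_n is (D_(n+1) U_n - U_(n-1) D_n) v; D vanishes on QP_0. The lower covers
   of x are finite by local finiteness, since they lie in [hatzero, x]. *)
Record differential_poset (r : nat) rk hatzero : Prop := DifferentialPoset {
  diff_graded : graded_by rk;
  diff_locally_finite : locally_finite;
  diff_bottom : forall x, minimal_elt x <-> x = hatzero;
  diff_upper_covers : forall x, finite_set (upper_covers x);
  diff_comm : forall (n : nat) (v : {freeg P / rat}),
    in_QP rk n v -> D (U v) - U (D v) = r%:R *: v
}.

Definition singleton_elt hatzero x : Prop :=
  x = hatzero \/ exists! y, covers y x.

Definition thread_elt hatzero x : Prop :=
  singleton_elt hatzero x /\ exists y, covers y x /\ singleton_elt hatzero y.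

Definition rank_size rk (n : nat) : nat := #|` fset_set (rank_set rk n)|.

Definition rank_gap rk (n : nat) : int :=
  if n is m.+1 then (rank_size rk m.+1)%:Z - (rank_size rk m)%:Z
  else (rank_size rk 0)%:Z.

Definition thread_count rk hatzero (n : nat) : nat :=
  #|` fset_set [set x | rank_set rk n x /\ thread_elt hatzero x]|.

End Poset.

(* Main.v *)
(* Let U and D act on functions on P, with the standard inner product on each
   rank. Every thread element is covered by another one that covers nothing
   else, so each thread of rank n continues upwards for ever: this gives tau_n
   elements of rank N such that D^i is isometric on their span for i <= N - n.
   This span meets the image of U trivially. Indeed, if v = U w lies in it, then
   the commutation relation gives sum_i (-1)^i |D^i v|^2 / (r^i i!) = 0 (the sum
   is the inner product of v with its projection on ker D), but since
   |D f|^2 <= r m |f|^2 on rank m and N >= 4n, the terms decrease, strictly at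
   i = 2 unless v = 0, and the sum is positive. As U is injective, it follows
   that p_(N-1) + tau_n <= p_N. *)
Require Import Defs.
From HB Require Import structures.
From mathcomp Require Import all_boot all_order all_algebra.
From mathcomp Require Import finmap boolp classical_sets cardinality.
From mathcomp Require Import freeg.
From mathcomp Require Import ring lra zify.

Set Implicit Arguments.
Unset Strict Implicit.
Unset Printing Implicit Defensive.

Import Order.TTheory GRing.Theory Num.Theory.

Local Open Scope classical_set_scope.
Local Open Scope ring_scope.

(** * Preliminaries: finite sums, a rank bound, alternating sums *)

HB.instance Definition _ (R : nzRingType) (K : choiceType) (M : lmodType R)
    (f : K -> M) :=
  GRing.isZmodMorphism.Build {freeg K / R} M (fglift f) (lift_is_additive f).

Lemma big_fset_filter (T : choiceType) (V : nmodType) (A B : {fset T})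
    (p : pred T) (F : T -> V) :
  (forall x, (x \in A) = (x \in B) && p x) ->
  \sum_(x <- A) F x = \sum_(x <- B | p x) F x.
Proof.
move=> eqAB; rewrite -[RHS]big_filter.
apply: (perm_big [seq x <- B | p x]); apply: uniq_perm.
- exact: fset_uniq.
- by rewrite filter_uniq ?fset_uniq.
- by move=> x; rewrite mem_filter andbC; exact: eqAB.
Qed.

(** The hypothesis says that the rows of the [X] by [Y] matrix [A] are independent, so their number
    is its rank, at most the number of columns. *)
Lemma fset_card_le_of_free (T : choiceType) (K : fieldType) (X Y : {fset T})
    (A : T -> T -> K) :
  (forall f : T -> K,
     (forall y, y \in Y -> \sum_(x <- X) f x * A x y = 0) ->
     forall x, x \in X -> f x = 0) ->
  (#|` X| <= #|` Y|)%N.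
Proof.
move=> freeA; rewrite !cardfE.
pose M := \matrix_(i < #|{: X}|, j < #|{: Y}|)
  A (val (enum_val i : X)) (val (enum_val j : Y)).
suff /eqP <- : row_free M by exact: rank_leq_col.
apply: inj_row_free => c cM0.
pose f t := if insub t is Some u then c 0 (enum_rank (u : X)) else 0.
have fE (u : X) : f (val u) = c 0 (enum_rank u) by rewrite /f valK.
have f0 : forall x, x \in X -> f x = 0.
  apply: freeA => y yY; rewrite big_seq_fsetE /=.
  have /rowP/(_ (enum_rank [` yY]%fset)) := cM0; rewrite !mxE => cMy.
  rewrite -[RHS]cMy.
  rewrite (reindex (@enum_val X predT)) /=; last first.
    by exists enum_rank => u _; rewrite ?enum_valK ?enum_rankK.
  by apply: eq_bigr => i _; rewrite fE enum_valK mxE enum_rankK.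
by apply/rowP => i; rewrite mxE -(enum_valK i) -fE f0 // fsvalP.
Qed.

(* [e k] is, up to sign, the [k]-th partial sum of the alternating series
   [a 0 - a 1 + a 2 - ...]. *)
Lemma alternating_partial_sum_neq0 (a e : nat -> rat) (N : nat) :
  (2 < N)%N -> e 0%N = a 0%N ->
  (forall i, (i < N)%N -> a i.+1 = e i.+1 + e i) ->
  (forall i, 0 <= a i) -> (forall i, (i < N)%N -> a i.+1 <= a i) ->
  a 3%N < a 2%N -> e N != 0.
Proof.
move=> N3 e0 rec a_ge0 a_dec a32.
(* Signs alternate from index 3 on, where [a 3 < a 2] starts the induction. The stronger bound for
   odd [k] makes the next value negative again. *)
have inv k : (k.+3 <= N)%N ->
    if odd k then a k.+3 < e k.+3 else e k.+3 < 0.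
  elim: k => [|k IHk] kN.
    have := rec 0%N; have := rec 1%N; have := rec 2%N; have := a_dec 0%N.
    move=> /(_ ltac:(lia)) d0 /(_ ltac:(lia)) r2 /(_ ltac:(lia)) r1.
    by move=> /(_ ltac:(lia)) r0 /=; lra.
  have := IHk (ltnW kN); have := rec _ kN; have := a_dec _ kN.
  by have := a_ge0 k.+4; rewrite /=; case: odd => /=; lra.
have := inv (N - 3)%N; rewrite -addn3 subnK // => /(_ (leqnn N)).
by have := a_ge0 N; case: odd; lra.
Qed.

Section DifferentialPoset.
Context {d : Order.disp_t} {P : porderType d}.
Context {rk : P -> nat} {hatzero : P} {r : nat}.
Hypothesis hP : differential_poset r rk hatzero.
Implicit Types (x y z : P) (f g v w : P -> rat).

(** * Ranks, covers and finiteness *)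

Lemma rk_lt x y : (x < y)%O -> (rk x < rk y)%N.
Proof. exact: (graded_lt (diff_graded hP)). Qed.

Lemma rk_covers x y : covers x y -> rk y = (rk x).+1.
Proof. exact: (graded_covers (diff_graded hP)). Qed.

Lemma hatzero_le x : (hatzero <= x)%O.
Proof.
have [k] := ubnP (rk x); elim: k x => // k IHk x /ltnSE rkx.
have [xmin|] := pselect (minimal_elt x).
  by have /(diff_bottom hP) -> := xmin.
move=> /existsNP[y /not_implyP[yx /eqP yNx]].
have ltyx : (y < x)%O by rewrite lt_neqAle yNx.
by apply: le_trans yx; apply: IHk; apply: leq_trans (rk_lt ltyx) rkx.
Qed.

Lemma rk_hatzero : rk hatzero = 0%N.
Proof. by apply: (graded_minimal (diff_graded hP)); apply/(diff_bottom hP). Qed.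

Lemma rk_eq0 x : rk x = 0%N -> x = hatzero.
Proof.
move=> rkx; apply/eqP; rewrite eq_sym; apply/negP => /negP x0.
have : (hatzero < x)%O by rewrite lt_neqAle x0 hatzero_le.
by move=> /rk_lt; rewrite rkx.
Qed.

Lemma exists_lower_cover x : (0 < rk x)%N -> exists y, covers y x.
Proof.
move=> rkx.
(* The induction is on a bound [k] for the rank gap between [x] and an element below it; an element
   between the two shrinks the gap. *)
have [k kx] : exists k, exists2 y, (y < x)%O & (rk x - rk y <= k)%N.
  exists (rk x), hatzero; last by rewrite leq_subr.
  rewrite lt_neqAle hatzero_le andbT; apply: contraTneq rkx => <-.
  by rewrite rk_hatzero.
elim: k kx => [|k IHk] [y yx ky].
  by have := rk_lt yx; rewrite -subn_gt0; move: ky; rewrite leqn0 => /eqP ->.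
have [cyx|] := pselect (covers y x); first by exists y.
move=> /not_andP[//|/existsNP[z /contrapT/andP[yz zx]]].
by apply: IHk; exists z => //; have := rk_lt yz; have := rk_lt zx; lia.
Qed.

Lemma lower_covers_finite x : finite_set (lower_covers x).
Proof.
apply: sub_finite_set (diff_locally_finite hP hatzero x) => y /= [yx _].
by rewrite hatzero_le ltW.
Qed.

Lemma rank_set_finite n : finite_set (rank_set rk n).
Proof.
elim: n => [|n IHn].
  by apply: sub_finite_set (finite_set1 hatzero) => x /=; exact: rk_eq0.
apply: sub_finite_set
  (bigcup_finite IHn (fun y _ => diff_upper_covers hP y)) => x /= rkx.
have [|y yx] := @exists_lower_cover x; first by rewrite rkx.
by exists y => //=; move: (rk_covers yx); rewrite rkx => -[].
Qed.

Definition level n : {fset P} := fset_set (rank_set rk n).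

Lemma mem_level n x : (x \in level n) = (rk x == n).
Proof.
rewrite in_fset_set; last exact: rank_set_finite.
by apply/idP/eqP; rewrite inE.
Qed.

Lemma mem_lower_covers x y :
  (x \in fset_set (lower_covers y)) = `[< covers x y >].
Proof.
rewrite in_fset_set; last exact: lower_covers_finite.
by apply/idP/asboolP; rewrite inE.
Qed.

Lemma mem_upper_covers x y :
  (y \in fset_set (upper_covers x)) = `[< covers x y >].
Proof.
rewrite in_fset_set; last exact: (diff_upper_covers hP).
by apply/idP/asboolP; rewrite inE.
Qed.

Lemma lower_covers_hatzero : fset_set (lower_covers hatzero) = fset0.
Proof.
apply/fsetP => x; rewrite mem_lower_covers in_fset0.
by apply/asboolP => -[/rk_lt]; rewrite rk_hatzero.
Qed.

(** * The commutation relation on functions *)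

(* The transposes of D and U, extended to arbitrary functions on P. *)
Definition up f y := \sum_(x <- fset_set (lower_covers y)) f x.
Definition down f x := \sum_(y <- fset_set (upper_covers x)) f y.

(** Apply to the commutation relation at [<< x >>] the linear functional [ev] that extends [f] to
    formal sums. *)
Lemma down_up f x : down (up f) x = up (down f) x + r%:R * f x.
Proof.
pose ev : {freeg P / rat} -> rat^o := fglift (f : P -> rat^o).
have evU y : ev << y >> = f y by rewrite /ev liftU scale1r.
have evD (s : seq P) (F : P -> {freeg P / rat}) :
  ev (\sum_(y <- s) F y) = \sum_(y <- s) ev (F y) by exact: raddf_sum.
have evDs (s : seq P) : ev (D (\sum_(y <- s) << y >>)) = \sum_(y <- s) up f y.
  rewrite /D raddf_sum evD; apply: eq_bigr => y _.
  by rewrite /= liftU scale1r evD; apply: eq_bigr => z _; exact: evU.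
have evUs (s : seq P) :
    ev (U (\sum_(y <- s) << y >>)) = \sum_(y <- s) down f y.
  rewrite /U raddf_sum evD; apply: eq_bigr => y _.
  by rewrite /= liftU scale1r evD; apply: eq_bigr => z _; exact: evU.
have /(congr1 ev) : D (U << x >>) - U (D << x >>) = r%:R *: << x >>.
  by apply: (diff_comm hP (n := rk x)) => y; rewrite domU1 inE => /eqP ->.
rewrite scaler_nat [LHS]raddfB [RHS]raddfMn /= -/ev evU -[f x *+ r]mulr_natl => /eqP.
rewrite subr_eq addrC => /eqP; rewrite [U << x >>]liftU [D << x >>]liftU.
by rewrite !scale1r evDs evUs.
Qed.

Lemma up_rk0 f x : rk x = 0%N -> up f x = 0.
Proof. by move=> /rk_eq0 ->; rewrite /up lower_covers_hatzero big_nil. Qed.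

Lemma down_lin f g c x :
  down (fun y => f y + c * g y) x = down f x + c * down g x.
Proof. by rewrite /down big_split /= mulr_sumr. Qed.

Lemma iter_down_up i w x :
  iter i.+1 down (up w) x =
    up (iter i.+1 down w) x + (r * i.+1)%:R * iter i down w x.
Proof.
elim: i x => [|i IHi] x; first by rewrite muln1 /= down_up.
rewrite [LHS]/= {1}/down (eq_bigr _ (fun y _ => IHi y)) -/(down _ x) down_lin.
by rewrite down_up -[down (iter i _ w)]/(iter i.+1 down w) mulnS natrD; ring.
Qed.

(** * Inner products and norm bounds *)

Definition dot n f g := \sum_(x <- level n) f x * g x.

Lemma eq_dotl n f f' g :
  (forall x, rk x = n -> f x = f' x) -> dot n f g = dot n f' g.
Proof.
by move=> eqf; apply: eq_big_seq => x; rewrite mem_level => /eqP /eqf ->.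
Qed.

Lemma dotC n f g : dot n f g = dot n g f.
Proof. by apply: eq_bigr => x _; rewrite mulrC. Qed.

Lemma dot_linl n f g h c :
  dot n (fun x => f x + c * g x) h = dot n f h + c * dot n g h.
Proof.
rewrite /dot mulr_sumr -big_split /=.
by apply: eq_bigr => x _; rewrite mulrDl mulrA.
Qed.

Lemma dot0l n g : dot n (fun=> 0) g = 0.
Proof. by rewrite /dot big1 // => x _; rewrite mul0r. Qed.

Lemma dot_ge0 n f : 0 <= dot n f f.
Proof. by apply: sumr_ge0 => x _; exact: sqr_ge0. Qed.

Lemma dot_eq0 n f : dot n f f = 0 -> forall x, rk x = n -> f x = 0.
Proof.
move=> /eqP; rewrite psumr_eq0; last by move=> x _; exact: sqr_ge0.
move=> /allP f0 x /eqP; rewrite -mem_level => /f0.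
by rewrite mulf_eq0 orbb => /eqP.
Qed.

Lemma dot_supp n (A : {fset P}) f g :
  (forall x, x \in A -> rk x = n) ->
  (forall x, rk x = n -> x \notin A -> f x = 0) ->
  dot n f g = \sum_(x <- A) f x * g x.
Proof.
move=> An f0; rewrite (@big_fset_filter _ _ _ (level n) (mem A)); last first.
  move=> x /=; rewrite mem_level andbC; case: (boolP (x \in A)) => //= xA.
  by rewrite An ?eqxx.
rewrite [RHS]big_mkcond; apply: eq_big_seq => x; rewrite mem_level => /eqP xn.
by case: ifPn => // /(f0 x xn) ->; rewrite mul0r.
Qed.

(** Both sides sum [f x * g y] over the covering pairs between ranks [n] and [n.+1]. *)
Lemma dot_up n f g : dot n.+1 (up f) g = dot n f (down g).
Proof.
transitivity (\sum_(y <- level n.+1)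
                \sum_(x <- level n | `[< covers x y >]) f x * g y).
  apply: eq_big_seq => y; rewrite mem_level => /eqP rky.
  rewrite /up mulr_suml; apply: big_fset_filter => x.
  rewrite mem_lower_covers mem_level; case: asboolP => [cxy|]; last first.
    by rewrite andbF.
  by move: (rk_covers cxy); rewrite rky => -[->]; rewrite eqxx.
rewrite (exchange_big_dep xpredT) //=.
apply: eq_big_seq => x; rewrite mem_level => /eqP rkx.
rewrite /down mulr_sumr; apply/esym/big_fset_filter => y.
rewrite mem_upper_covers mem_level; case: asboolP => [cxy|]; last first.
  by rewrite andbF.
by rewrite (rk_covers cxy) rkx eqxx.
Qed.

Lemma dot_up_up n f :
  dot n.+1 (up f) (up f) = dot n (up (down f)) f + r%:R * dot n f f.
Proof.
rewrite dot_up dotC -dot_linl; apply: eq_dotl => x _; exact: down_up.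
Qed.

(** The discarded term is the squared norm of [down f], or 0 in rank 0. For [r > 0] the bound makes
    [up] injective on each rank. *)
Lemma dot_up_ge n f : r%:R * dot n f f <= dot n.+1 (up f) (up f).
Proof.
rewrite dot_up_up lerDr; case: n => [|n]; last by rewrite dot_up dot_ge0.
by rewrite (@eq_dotl _ _ (fun=> 0)) ?dot0l // => x; exact: up_rk0.
Qed.

(** With [g = down f], adjointness gives <up g, f> = |g|^2, so |up g - c f|^2 >= 0 yields c (c |f|^2
    - |g|^2) >= 0. *)
Lemma dot_down_le_of_up n c f : 0 < c ->
  (forall g, dot n.+1 (up g) (up g) <= c * dot n g g) ->
  dot n (down f) (down f) <= c * dot n.+1 f f.
Proof.
move=> c0 /(_ (down f)); set g := down f => up_le.
have := dot_ge0 n.+1 (fun x => up g x + (- c) * f x).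
rewrite dot_linl [dot _ (up g) _]dotC [dot _ f _]dotC !dot_linl.
rewrite [dot _ f (up g)]dotC [dot _ (up g) f]dot_up -/g => sq_ge0.
by rewrite -subr_ge0 -(pmulr_rge0 _ c0); lra.
Qed.

(** By induction: the commutation relation turns a bound for [down] into one for [up] with constant
    larger by [r], and transposing gives [down] one rank higher. *)
Lemma dot_down_le m f : (0 < r)%N ->
  dot m (down f) (down f) <= (r * m.+1)%:R * dot m.+1 f f.
Proof.
move=> r0; have c0 n : 0 < (r * n.+1)%:R :> rat by rewrite ltr0n muln_gt0 r0.
elim: m f => [|m IHm] f; apply: dot_down_le_of_up => // g; rewrite dot_up_up.
  rewrite (@eq_dotl _ _ (fun=> 0)); last by move=> x; exact: up_rk0.
  by rewrite dot0l add0r muln1.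
by rewrite dot_up mulnS natrD mulrDl addrC lerD2l; exact: IHm.
Qed.

(** * Threads and their upward continuation *)

Lemma card_lower_singleton x :
  singleton_elt hatzero x -> (#|` fset_set (lower_covers x)| <= 1)%N.
Proof.
move=> [->|[y [_ uniqy]]]; first by rewrite lower_covers_hatzero cardfs0.
rewrite -(cardfs1 y); apply: fsubset_leq_card; apply/fsubsetP => z.
by rewrite mem_lower_covers inE => /asboolP /uniqy ->.
Qed.

Lemma sum_fset1 (A : {fset P}) : \sum_(x <- A) 1 = #|` A|%:R :> rat.
Proof. by rewrite big_const_seq count_predT iter_addr_0. Qed.

(** The commutation relation at the indicator function of [x]. *)
Lemma card_upper_covers x :
  #|` fset_set (upper_covers x)| = (#|` fset_set (lower_covers x)| + r)%N.
Proof.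
have := down_up (fun z => (z == x)%:R) x; rewrite /down /up eqxx mulr1.
rewrite (eq_big_seq (fun=> 1)) => [|y].
  rewrite [in RHS](eq_big_seq (fun=> 1)) => [|y].
    by rewrite !sum_fset1 -natrD => /eqP; rewrite eqr_nat => /eqP.
  rewrite mem_lower_covers -mem_upper_covers => xy.
  rewrite (bigD1_seq x) //= ?eqxx ?fset_uniq // big1 ?addr0 // => z.
  by move=> /negPf ->.
rewrite mem_upper_covers -mem_lower_covers => xy.
rewrite (bigD1_seq x) //= ?eqxx ?fset_uniq // big1 ?addr0 // => z.
by move=> /negPf ->.
Qed.

(* If every upper cover of x had two lower covers, there would be at least
   2(r+1) pairs (z, z') where z covers both x and z', whereas the commutation
   relation makes their number r plus the number of upper covers of y. *)
Lemma thread_extends x : thread_elt hatzero x ->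
  exists z, covers x z /\ fset_set (lower_covers z) = [fset x]%fset.
Proof.
move=> [sx [y [yx sy]]].
have Lx : fset_set (lower_covers x) = [fset y]%fset.
  apply/esym/eqP; rewrite eqEfcard cardfs1 card_lower_singleton // andbT.
  by rewrite fsub1set mem_lower_covers; apply/asboolP.
apply: contrapT => no_z.
have : down (up (fun=> 1)) x <= (2 * r + 1)%:R.
  rewrite down_up /up Lx big_seq_fset1 /down sum_fset1 card_upper_covers.
  rewrite mulr1 -natrD ler_nat.
  by have := card_lower_singleton sy; lia.
have : (2 * r + 2)%:R <= down (up (fun=> 1)) x.
  have -> : (2 * r + 2)%:R = \sum_(z <- fset_set (upper_covers x)) 2%:R :> rat.
    rewrite big_const_seq count_predT iter_addr_0 card_upper_covers Lx cardfs1.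
    by rewrite -mulrnA; congr (_%:R); lia.
  rewrite /down [X in X <= _]big_seq [X in _ <= X]big_seq.
  apply: ler_sum => z; rewrite mem_upper_covers => /asboolP xz.
  rewrite /up sum_fset1 ler_nat ltnNge; apply/negP => Lz.
  apply: no_z; exists z; split=> //; apply/esym/eqP.
  rewrite eqEfcard cardfs1 Lz andbT fsub1set mem_lower_covers.
  exact/asboolP.
move=> le1 le2; have := le_trans le1 le2; rewrite ler_nat; lia.
Qed.

Definition thread_set m (A : {fset P}) :=
  forall x, x \in A -> rk x = m /\ thread_elt hatzero x.

Definition supported m (A : {fset P}) f :=
  forall x, rk x = m -> x \notin A -> f x = 0.

(** Each [x] in [A] moves to a cover [s x] whose only lower cover is [x]. On functions supported on
    the image, [down] merely relabels along [s]. *)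
Lemma thread_set_step m (A : {fset P}) : thread_set m A ->
  exists B : {fset P}, [/\ #|` B| = #|` A|, thread_set m.+1 B &
    forall v, supported m.+1 B v ->
      supported m A (down v) /\ dot m (down v) (down v) = dot m.+1 v v].
Proof.
move=> thA.
have /choice[s sP] : forall x, exists z, x \in A ->
    covers x z /\ fset_set (lower_covers z) = [fset x]%fset.
  move=> x; case: (boolP (x \in A)) => [xA|]; last by exists x.
  by have [_ /thread_extends[z zP]] := thA x xA; exists z.
have s_inj : {in A &, injective s}.
  move=> x x' xA x'A eqs; apply/eqP; rewrite -in_fset1.
  by rewrite -(sP x' x'A).2 -eqs (sP x xA).2 fset11.
have sBE x x' : x' \in A -> covers x (s x') -> x = x'.
  move=> x'A xs; apply/eqP; rewrite -in_fset1 -(sP x' x'A).2 mem_lower_covers.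
  exact/asboolP.
pose B := [fset s x | x in A]%fset.
have thB : thread_set m.+1 B.
  move=> _ /imfsetP[x /= xA ->]; have [rkx [sx _]] := thA x xA.
  have [xs Ls] := sP x xA; split; first by rewrite (rk_covers xs) rkx.
  by split; [right|]; exists x; split=> // x' /(sBE _ _ xA) ->.
exists B; split=> //; first by rewrite card_in_imfset.
move=> v vB.
have vs x : x \in A -> down v x = v (s x).
  move=> xA; have [xs Ls] := sP x xA; have [rkx _] := thA x xA.
  rewrite /down (bigD1_seq (s x)) ?fset_uniq //=; last first.
    by rewrite mem_upper_covers; apply/asboolP.
  rewrite big_seq_cond big1 ?addr0 // => y.
  rewrite mem_upper_covers => /andP[/asboolP xy yNs].
  apply: vB; first by rewrite (rk_covers xy) rkx.
  apply: contraNN yNs => /imfsetP[x' /= x'A yE].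
  by move: xy; rewrite yE => /(sBE _ _ x'A) ->.
have v0 : supported m A (down v).
  move=> x rkx xNA; rewrite /down big_seq big1 // => y.
  rewrite mem_upper_covers => /asboolP xy.
  apply: vB; first by rewrite (rk_covers xy) rkx.
  apply: contraNN xNA => /imfsetP[x' /= x'A yE].
  by move: xy; rewrite yE => /(sBE _ _ x'A) ->.
split=> //; rewrite (@dot_supp _ A) => [|x /thA[]//|//].
rewrite (@dot_supp _ B) => [|x /thB[]//|//].
by rewrite big_imfset //=; apply: eq_big_seq => x xA; rewrite vs.
Qed.

Lemma thread_set_iter m (A : {fset P}) k : thread_set m A ->
  exists B : {fset P}, [/\ #|` B| = #|` A|, thread_set (m + k) B &
    forall v, supported (m + k) B v -> forall i, (i <= k)%N ->
      dot (m + k - i) (iter i down v) (iter i down v) = dot (m + k) v v].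
Proof.
move=> thA; elim: k => [|k [B [cardB thB isoB]]].
  by exists A; rewrite addn0; split=> // v _ i; rewrite leqn0 => /eqP ->;
    rewrite subn0.
have [B' [cardB' thB' isoB']] := thread_set_step thB.
exists B'; rewrite addnS; split=> //; first by rewrite cardB'.
move=> v /isoB'[supp_down dot_down] [|i] ik; first by rewrite subn0.
by rewrite !iterSr subSS isoB.
Qed.

(** * Trivial intersection with the image of [up], and the count *)

(* Here [e i] is <U D^i w, D^i v> / (r^i i!), which vanishes at i = N because
   U f vanishes at the bottom element. *)
Lemma up_eq0_of_isometry n N w : (0 < r)%N -> (0 < n)%N -> (4 * n <= N)%N ->
  (forall i, (i <= N - n)%N ->
     dot (N - i) (iter i down (up w)) (iter i down (up w)) =
       dot N (up w) (up w)) ->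
  dot N (up w) (up w) = 0.
Proof.
move=> r0 n0 nN iso; set v := up w in iso *.
have [//|X0] := eqVneq (dot N v v) 0.
have {}X0 : 0 < dot N v v by rewrite lt_neqAle eq_sym X0 dot_ge0.
pose den i : rat := (r ^ i * i`!)%:R.
have den_gt0 i : 0 < den i by rewrite ltr0n muln_gt0 expn_gt0 r0 fact_gt0.
have denS i : den i.+1 = den i * (r * i.+1)%:R.
  by rewrite -natrM; congr (_%:R); rewrite expnS factS; ring.
pose a i := dot (N - i) (iter i down v) (iter i down v) / den i.
pose e i := dot (N - i) (up (iter i down w)) (iter i down v) / den i.
have rS i : 0 < (r * i.+1)%:R :> rat by rewrite ltr0n muln_gt0 r0.
have : e N != 0.
  apply: (@alternating_partial_sum_neq0 a e N) => //; first by lia.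
  (* Adjointness turns the second term of [iter_down_up] into the numerator of [e i]; its factor
     [r * i.+1] cancels in [den i.+1]. *)
  - move=> i iN; rewrite /a /e; have -> : (N - i = (N - i.+1).+1)%N by lia.
    rewrite (eq_dotl _ (fun x _ => iter_down_up i w x)) dot_linl mulrDl.
    congr (_ + _); rewrite dot_up denS invfM mulrA.
    by rewrite mulrAC [_ * dot _ _ _]mulrC mulfK ?gt_eqF.
  - by move=> i; rewrite divr_ge0 ?dot_ge0 // ltW.
  (* While [i < N - n] the norms agree. Afterwards the squared norm grows by at most [r * (N - i)],
     and [N - i <= n <= i.+1]. *)
  - move=> i iN; rewrite /a denS invfM mulrA mulrAC ler_pM2r ?invr_gt0 //.
    rewrite ler_pdivrMr // mulrC; case: (leqP i.+1 (N - n)) => iM.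
      by rewrite !iso ?(ltnW iM) // ler_peMl ?dot_ge0 // ler1n muln_gt0 r0.
    have -> : (N - i = (N - i.+1).+1)%N by lia.
    apply: le_trans (dot_down_le _ _ r0) _.
    by rewrite ler_wpM2r ?dot_ge0 // ler_nat leq_mul2l; lia.
  (* From [n >= 1] and [N >= 4 * n] comes [N - n >= 3], so indices 2 and 3 are in the isometric
     range and the ratio of the terms is 1 / (3 r). *)
  - rewrite /a !iso; [|lia..].
    rewrite ltr_pM2l // ltf_pV2 ?qualifE //= (denS 2%N) ltr_pMr // ltr1n.
    lia.
suff -> : e N = 0 by rewrite eqxx.
rewrite /e subnn (@eq_dotl _ _ (fun=> 0)) ?dot0l ?mul0r // => x.
exact: up_rk0.
Qed.

Lemma thread_card_le n N (A : {fset P}) : (0 < r)%N -> (4 * n <= N.+1)%N ->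
  thread_set n A -> (#|` A| + #|` level N| <= #|` level N.+1|)%N.
Proof.
move=> r0 nN thA.
have [B []] : exists B : {fset P}, [/\ #|` B| = #|` A|,
    forall x, x \in B -> rk x = N.+1 &
    forall w, supported N.+1 B (up w) -> dot N.+1 (up w) (up w) = 0].
  (* Rank 0 has no thread elements, so [A] is empty there; the isometry argument requires
     [0 < n]. *)
  have [n0|n0] := posnP n.
    exists fset0; split=> [|x|w supp0]; rewrite ?inE //.
      apply/esym/eqP; rewrite cardfs_eq0; apply/eqP/fsetP => x; rewrite inE.
      apply/negP => /thA[rkx [_ [y [/rk_covers]]]].
      by rewrite rkx n0.
    rewrite (@eq_dotl _ _ (fun=> 0)) => [|x rkx]; last by rewrite supp0 ?inE.
    exact: dot0l.
  have [B [cardB thB isoB]] := thread_set_iter (N.+1 - n) thA.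
  have nNE : (n + (N.+1 - n) = N.+1)%N by lia.
  rewrite nNE in thB isoB; exists B; split=> // [x /thB[]//|w /isoB iso].
  exact: up_eq0_of_isometry nN iso.
move=> <- rkB up0.
have disj : [disjoint B & level N]%fset.
  apply/fdisjointP => x /rkB rkx; rewrite mem_level rkx; lia.
have mem_NB x : x \in level N -> x \notin B.
  by rewrite mem_level; apply: contraTN => /rkB ->; rewrite gtn_eqF.
rewrite -cardfsUI (_ : B `&` level N = fset0)%fset ?cardfs0 ?addn0; last first.
  exact/eqP.
(* Rows from rank [N] list upper covers, rows from [B] are unit vectors. A relation [f] among them
   reads [up f = - v] with [v] supported on [B]. *)
apply: (@fset_card_le_of_free _ rat _ _ (fun x y =>
  if rk x == N then `[< covers x y >]%:R else (x == y)%:R)) => f sum0.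
pose v x := if x \in B then f x else 0.
have upE y : rk y = N.+1 -> up f y = - v y.
  move=> rky; apply/eqP; rewrite -addr_eq0 addrC; apply/eqP.
  have yN : y \in level N.+1 by rewrite mem_level rky.
  rewrite -[RHS](sum0 y yN).
  rewrite (perm_big (enum_fset B ++ enum_fset (level N))); last first.
    apply: uniq_perm; rewrite ?fset_uniq // ?cat_uniq ?fset_uniq /=.
      by rewrite andbT; apply/hasPn.
    by move=> x; rewrite mem_cat in_fsetU.
  rewrite big_cat /=; congr (_ + _).
    transitivity (\sum_(x <- B) if x == y then f x else 0).
      rewrite -big_mkcond /v; case: ifP => yB.
        rewrite big_mkcond (bigD1_seq y) ?fset_uniq //= eqxx big1 ?addr0 //.
        by move=> x /negPf ->.
      rewrite big_seq_cond big1 // => x /andP[xB /eqP xy].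
      by rewrite xy yB in xB.
    apply: eq_big_seq => x /rkB ->; rewrite gtn_eqF //.
    by case: eqP; rewrite ?mulr1 ?mulr0.
  rewrite /up (@big_fset_filter _ _ _ (level N) (fun x => `[< covers x y >])).
    rewrite big_mkcond; apply: eq_big_seq => x; rewrite mem_level => ->.
    by case: asboolP; rewrite ?mulr1 ?mulr0.
  move=> x; rewrite mem_lower_covers mem_level; case: asboolP => [xy|].
    by move: (rk_covers xy); rewrite rky => -[->]; rewrite eqxx.
  by rewrite andbF.
have up_supp : supported N.+1 B (up f).
  by move=> y rky yNB; rewrite upE // /v (negPf yNB) oppr0.
have {up_supp} up_eq0 := up0 f up_supp.
(* Now [up f] has norm 0: injectivity kills [f] on rank [N], and [v = - up f] kills it on [B]. *)
move=> x; rewrite in_fsetU => /orP[xB|]; last first.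
  rewrite mem_level => /eqP; apply: dot_eq0; apply/eqP.
  rewrite eq_le dot_ge0 andbT -(pmulr_rle0 _ (_ : 0 < r%:R)) ?ltr0n //.
  by rewrite -[leRHS]up_eq0 dot_up_ge.
by have := upE x (rkB x xB); rewrite (dot_eq0 up_eq0) ?rkB // /v xB => /eqP;
  rewrite eq_sym oppr_eq0 => /eqP.
Qed.

End DifferentialPoset.

Theorem theorem3p3 (d : Order.disp_t) (P : porderType d) (rk : P -> nat)
    (hatzero : P) (r : nat) (hr : (0 < r)%N)
    (hP : differential_poset r rk hatzero)
    (n N : nat) (hN : (4 * n <= N)%N) :
  ((thread_count rk hatzero n)%:Z <= rank_gap rk N)%R.
Proof.
rewrite /thread_count; set A := fset_set _.
have thA : thread_set (rk := rk) (hatzero := hatzero) n A.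
  move=> x; rewrite in_fset_set ?inE //.
  by apply: sub_finite_set (rank_set_finite hP n) => y [].
case: N hN => [|N] nN /=; last first.
  by rewrite lerBrDr -PoszD lez_nat; exact: (thread_card_le hP hr nN thA).
(* For [N = 0] the gap is the size of rank 0 itself, so inclusion suffices. *)
have n0 : n = 0%N by lia.
rewrite lez_nat; apply: fsubset_leq_card; apply/fsubsetP => x /thA[rkx _].
by rewrite (mem_level hP) rkx n0.
Qed.
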